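(* Let $d\in\mathbb{N}$, $\alpha,\gamma,\nu\in(0,\infty)$, $\xi\in\mathbb{R}^d$, let $\langle\cdot,\cdot\rangle\colon\mathbb{R}^d\times\mathbb{R}^d\to\mathbb{R}$ be the $d$-dimensional Euclidean scalar product, let $\|\cdot\|\colon\mathbb{R}^d\to[0,\infty)$ be the $d$-dimensional Euclidean norm, let $(\Omega,\mathcal{F},\mathbb{P})$ be a probability space, and let $X_n\colon\Omega\to\mathbb{R}^d$, $n\in\mathbb{N}$, be i.i.d. random variables with $\mathbb{E}[\|X_1\|^2]<\infty$ and $\mathbb{P}(X_1=\mathbb{E}[X_1])<1$. For all $\varepsilon\in(0,\infty)$, $i\in\{0,1\}$ let $$r_{\varepsilon,i}=\begin{cases}\nu/2 & \text{if } \nu<1,\\ \min\{1/2,\ \gamma\alpha+(-1)^i\varepsilon\} & \text{if } \nu=1,\\ 0 & \text{if } \nu>1.\end{cases}$$ Let $F\colon\mathbb{R}^d\times\mathbb{R}^d\to\mathbb{R}$ and $f\colon\mathbb{R}^d\to\mathbb{R}$ satisfy for all $\theta,x\in\mathbb{R}^d$ that $F(\theta,x)=\frac{\alpha}{2}\|\theta-x\|^2$ and $f(\theta)=\mathbb{E}[F(\theta,X_1)]$, and let $\Theta\colon\mathbb{N}_0\times\Omega\to\mathbb{R}^d$ be the stochastic process which satisfies for all $n\in\mathbb{N}$ that $\Theta_0=\xi$ and $\Theta_n=\Theta_{n-1}-\frac{\gamma}{n^\nu}(\nabla_\theta F)(\Theta_{n-1},X_n)$. Then (i) it holds for all $\theta\in\mathbb{R}^d$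 that $f(\theta)=\frac{\alpha}{2}\|\theta-\mathbb{E}[X_1]\|^2+\frac{\alpha}{2}\mathbb{E}[\|X_1-\mathbb{E}[X_1]\|^2]$, (ii) it holds that $\{\theta\in\mathbb{R}^d\colon f(\theta)=\inf_{w\in\mathbb{R}^d}f(w)\}=\{\mathbb{E}[X_1]\}$, (iii) it holds for all $\theta\in\mathbb{R}^d$ that $\langle\theta-\mathbb{E}[X_1],(\nabla f)(\theta)\rangle=\alpha\|\theta-\mathbb{E}[X_1]\|^2$, (iv) it holds for all $\theta\in\mathbb{R}^d$ that $\|(\nabla f)(\theta)\|=\alpha\|\theta-\mathbb{E}[X_1]\|$, (v) it holds for all $\theta\in\mathbb{R}^d$ that $\mathbb{E}[\|(\nabla_\theta F)(\theta,X_1)-(\nabla f)(\theta)\|^2]=\alpha^2\,\mathbb{E}[\|X_1-\mathbb{E}[X_1]\|^2]$, (vi) for every $\varepsilon\in(0,\infty)$ there exist $C_0,C_1\in(0,\infty)$ such that for all $n\in\mathbb{N}$ it holds that $$C_0\,n^{-r_{\varepsilon,0}}\le\big(\mathbb{E}[\|\Theta_n-\mathbb{E}[X_1]\|^2]\big)^{1/2}\le C_1\,n^{-r_{\varepsilon,1}},$$ and (vii) for every $\varepsilon\in(0,\infty)$ there exist $C_0,C_1\in(0,\infty)$ such that for all $n\in\mathbb{N}$ it holds that $$C_0\,n^{-2r_{\varepsilon,0}}\le\mathbb{E}[f(\Theta_n)]-f(\mathbb{E}[X_1])\le C_1\,n^{-2r_{\varepsilon,1}}.$$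
   Context: $\mathbb{N}=\{1,2,3,\ldots\}$ and $\mathbb{N}_0=\mathbb{N}\cup\{0\}$. $\nabla_\theta F$ denotes the gradient of $F(\theta,x)$ with respect to its first argument $\theta$. $\Theta_n$ denotes the random variable $\omega\mapsto\Theta(n,\omega)$. *)

(* Defs.v *)
From HB Require Import structures.
From mathcomp Require Import all_boot all_order all_algebra.
From mathcomp Require Import all_classical all_reals all_analysis.

Set Implicit Arguments.
Unset Strict Implicit.
Unset Printing Implicit Defensive.

Import Order.TTheory GRing.Theory Num.Theory.
Import numFieldNormedType.Exports.

Local Open Scope classical_set_scope.
Local Open Scope ring_scope.

Section euclidean_space.
Context {R : realType} {d : nat}.
Implicit Types u v : 'rV[R]_d.

Definition dotp u v : R := \sum_(i < d) u 0 i * v 0 i.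

(* The library norm `|u| on 'rV[R]_d is the max norm, hence this definition;
   both norms induce the same topology, so the library's [open], [derive] and
   [differentiable] can be used as they are. *)
Definition enorm u : R := Num.sqrt (dotp u u).

Definition gradient (f : 'rV[R]_d -> R) (x : 'rV[R]_d) : 'rV[R]_d :=
  \row_(i < d) 'D_(delta_mx 0 i) f x.

End euclidean_space.

(* R^d with its Borel sigma-algebra *)
Definition borel_rV (R : realType) (d : nat) :=
  g_sigma_algebraType (@open 'rV[R]_d).

Section random_vectors.
Context {R : realType} {d : nat} {disp : measure_display}.
Context {Omega : measurableType disp} (P : probability Omega R).

Definition random_vector (X : Omega -> 'rV[R]_d) : Prop :=
  measurable_fun setT (X : Omega -> borel_rV R d).

(* componentwise expectation; [fine] is harmless for integrable X *)
Definition mean_vector (X : Omega -> 'rV[R]_d) : 'rV[R]_d :=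
  \row_(i < d) fine 'E_P[fun w => X w 0 i].

Definition mutually_independent (I : set nat)
    (X : nat -> Omega -> 'rV[R]_d) : Prop :=
  forall (s : seq nat) (B : nat -> set (borel_rV R d)),
    uniq s -> (forall i, i \in s -> I i) ->
    (forall i, i \in s -> measurable (B i)) ->
    P (\bigcap_(i in [set` s]) (X i @^-1` B i)) =
    (\prod_(i <- s) P (X i @^-1` B i))%E.

Definition identically_distributed (I : set nat)
    (X : nat -> Omega -> 'rV[R]_d) : Prop :=
  forall i j, I i -> I j -> forall B : set (borel_rV R d), measurable B ->
    P (X i @^-1` B) = P (X j @^-1` B).

Definition iid (I : set nat) (X : nat -> Omega -> 'rV[R]_d) : Prop :=
  [/\ forall i, I i -> random_vector (X i),
      mutually_independent I X & identically_distributed I X].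

End random_vectors.

Definition rate {R : realType} (alpha gamma nu eps : R) (i : nat) : R :=
  if nu < 1 then nu / 2
  else if nu == 1 then Num.min (1 / 2) (gamma * alpha + (-1) ^+ i * eps)
  else 0.

(* Main.v *)
(** Since grad_theta F(theta, x) = alpha (theta - x), the error satisfies
    Theta_n - m = (1 - a_n) (Theta_(n-1) - m) + a_n (X_n - m) with
    a_n = gamma alpha n^(-nu).  Coordinatewise, Theta_(n-1) - m is a linear
    combination of a constant and of X_1 - m, ..., X_(n-1) - m, so it is
    uncorrelated with X_n - m as soon as the X_i are pairwise independent, and
    e_n = E|Theta_n - m|^2 obeys the scalar recursion
      e_n = (1 - a_n)^2 e_(n-1) + a_n^2 V,   V = E|X_1 - m|^2 > 0.
    Both rates follow by comparing e_n with C n^(-q): Bernoulli's inequality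
    controls n^(-q) / (n+1)^(-q), and for nu > 1 the lower bound comes from the
    subsolution 1 + K n^(1-nu), which stays away from 0. *)

Require Import Defs.
From HB Require Import structures.
From mathcomp Require Import all_boot all_order all_algebra.
From mathcomp Require Import all_classical all_reals all_analysis.
From mathcomp Require Import measurable_realfun ring lra.

Set Implicit Arguments.
Unset Strict Implicit.
Unset Printing Implicit Defensive.

Import Order.TTheory GRing.Theory Num.Theory.
Import numFieldNormedType.Exports.

Local Open Scope classical_set_scope.
Local Open Scope ring_scope.

(** * The scalar recursion *)

Section powR_facts.
Context {R : realType}.

(** Concavity of the logarithm between 1 and 1 + x with weight q, where ln 1 = 0 removes one term;
    exponentiating gives the claim. *)
Lemma powR_bernoulli (q x : R) : 0 <= q <= 1 -> -1 < x ->
  (1 + x) `^ q <= 1 + q * x.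
Proof.
move=> /andP[q0 q1] x1.
have x1' : 0 < 1 + x by lra.
have qx : 0 < 1 + q * x by have [x0|x0] := leP 0 x; nra.
rewrite -[leRHS]lnK ?posrE// /powR gt_eqF// ler_expR.
have := @concave_ln R (Itv01 q0 q1) (1 + x) 1 x1' ltr01.
rewrite !convRE /= ln1 mulr0 addr0 (_ : q * (1 + x) + _ = 1 + q * x)//.
by rewrite /unstable.onem; ring.
Qed.

Lemma powRN_cvg0 (nu eta : R) : 0 < nu -> 0 < eta ->
  exists N, forall n, (N <= n)%N -> (0 < n)%N -> n%:R `^ (- nu) <= eta.
Proof.
move=> nu0 eta0.
have b0 : 0 <= eta `^ (- nu^-1) by exact: powR_ge0.
(* Raising n >= eta^(-1/nu) to the power nu and inverting gives n^(-nu) <= eta. *)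
exists (Num.bound (eta `^ (- nu^-1))) => n nN n0.
have n0' : (0 : R) < n%:R by rewrite ltr0n.
have h : eta `^ (- nu^-1) <= n%:R.
  apply: ltW; apply: lt_le_trans (archi_boundP b0) _.
  by rewrite ler_nat.
have := @ge0_ler_powR _ nu (ltW nu0) _ _ _ _ h.
rewrite !nnegrE b0 (ltW n0') => /(_ isT isT).
rewrite -powRrM mulNr mulVf ?gt_eqF// powR_inv1 ?(ltW eta0)// => h2.
by rewrite powRN -[leRHS]invrK lef_pV2 ?posrE ?invr_gt0// powR_gt0.
Qed.

Lemma powRN_nonincreasing (q x y : R) : 0 <= q -> 0 < x -> x <= y ->
  y `^ (- q) <= x `^ (- q).
Proof.
move=> q0 x0 xy; have y0 : 0 < y by exact: lt_le_trans xy.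
rewrite !powRN lef_pV2 ?posrE ?powR_gt0//.
by apply: ge0_ler_powR => //; rewrite nnegrE ltW.
Qed.

Lemma powRN_exponent_anti (p q : R) n : (0 < n)%N -> p <= q ->
  n%:R `^ (- q) <= n%:R `^ (- p) :> R.
Proof. by move=> n0 pq; apply: ler_powR; rewrite ?ler1n// lerN2. Qed.

(** Combines exp y >= 1 + y with ln (1 + x) <= x, so every exponent s >= 0 is allowed. *)
Lemma powRN_bernoulli (s x : R) : 0 <= s -> -1 < x ->
  1 - s * x <= (1 + x) `^ (- s).
Proof.
move=> s0 x1; have x1' : 0 < 1 + x by lra.
rewrite /powR gt_eqF// mulNr; apply: le_trans (expR_ge1Dx _).
by rewrite lerD2l lerN2 ler_wpM2l// le_ln1Dx.
Qed.

Lemma subr1_invS n : 1 - n.+1%:R^-1 = n%:R / n.+1%:R :> R.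
Proof.
have n0 : n.+1%:R != 0 :> R by rewrite pnatr_eq0.
by apply: (mulIf n0); rewrite divfK// mulrBl mulVf// mul1r -natr1 addrK.
Qed.

(** A discrete form of the derivative of n^(-s): factor out (n+1)^(-s) and apply [powRN_bernoulli]
    at -1/(n+1). With s = nu - 1 the left side is s times the step-size power (n+1)^(-nu). *)
Lemma powRN_decrement (s : R) n : 0 < s -> (0 < n)%N ->
  s * n.+1%:R `^ (- (s + 1)) <= n%:R `^ (- s) - n.+1%:R `^ (- s).
Proof.
move=> s0 n0.
have n10 : (0 : R) < n.+1%:R by rewrite ltr0n.
have n0' : (0 : R) < n%:R by rewrite ltr0n.
have xE := subr1_invS n.
have -> : n%:R `^ (- s) = (n%:R / n.+1%:R) `^ (- s) * n.+1%:R `^ (- s) :> R.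
  by rewrite -powRM ?divr_ge0 ?ler0n// divfK// gt_eqF.
have -> : n.+1%:R `^ (- (s + 1)) = n.+1%:R^-1 * n.+1%:R `^ (- s) :> R.
  by rewrite opprD powRD ?pnatr_eq0 ?implybT// powR_inv1 ?ler0n// mulrC.

rewrite -[X in _ - X]mul1r -mulrBl mulrA ler_wpM2r ?powR_ge0// -xE.
rewrite -[leLHS]opprK lerBrDl -mulrN; apply: powRN_bernoulli; first exact: ltW.
by rewrite ltrN2 invf_lt1// ltr1n ltnS.
Qed.

End powR_facts.

(** * Upper and lower power bounds for the scalar recursion *)

Section sgd_recursion.
Context {R : realType}.
Variables (c nu V : R) (e : nat -> R).
Hypotheses (c0 : 0 < c) (nu0 : 0 < nu) (V0 : 0 < V) (e0 : 0 <= e 0).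
Let p n : R := n%:R `^ (- nu).
Hypothesis eS : forall n,
  e n.+1 = (1 - c * p n.+1) ^+ 2 * e n + (c * p n.+1) ^+ 2 * V.

Let p_gt0 n : 0 < p n.+1.
Proof. by rewrite powR_gt0// ltr0n. Qed.

Let p_le1 n : p n.+1 <= 1.
Proof.
rewrite -(powRr0 n.+1%:R) /p -[X in _ <= _ `^ X]oppr0.
by apply: powRN_exponent_anti => //; exact: ltW.
Qed.

Let e_ge0 n : 0 <= e n.
Proof.
elim: n => [//|n IHn].
by rewrite eS addr_ge0// mulr_ge0// ?sqr_ge0// ltW.
Qed.

Let e_gt0 n : 0 < e n.+1.
Proof.
rewrite eS ltr_wpDl//; first by rewrite mulr_ge0// sqr_ge0.
by rewrite mulr_gt0// exprn_gt0// mulr_gt0.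
Qed.

(** The threshold is lowered one index at a time, the constant being enlarged by the ratio
    [u N / g N] at each index absorbed. *)
Lemma eventually_le_bound (u g : nat -> R) N M :
  (forall n, (0 < n)%N -> 0 < g n) ->
  (forall n, (N <= n)%N -> (0 < n)%N -> u n <= M * g n) ->
  exists2 C, 0 < C & forall n, (0 < n)%N -> u n <= C * g n.
Proof.
move=> g0; elim: N M => [|N IHN] M uM.
  exists (Num.max 1 M); first by rewrite lt_max ltr01.
  move=> n n0; apply: le_trans (uM n (leq0n n) n0) _.
  by rewrite ler_pM2r ?g0// le_max lexx orbT.
apply: (IHN (Num.max M (u N / g N))) => n; rewrite leq_eqVlt => /orP[/eqP <-|Nn] n0.
  rewrite -[leLHS](@divfK _ (g N)) ?gt_eqF ?g0//.
  by rewrite ler_pM2r ?g0// le_max lexx orbT.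
by apply: le_trans (uM _ Nn n0) _; rewrite ler_pM2r ?g0// le_max lexx.
Qed.

(** The previous lemma with [g] bounded by multiples of [e]; this works because [e] is positive from
    index 1 on. *)
Lemma eventually_ge_bound (g : nat -> R) N M : 0 < M ->
  (forall n, (0 < n)%N -> 0 < g n) ->
  (forall n, (N <= n)%N -> (0 < n)%N -> M * g n <= e n) ->
  exists2 C, 0 < C & forall n, (0 < n)%N -> C * g n <= e n.
Proof.
move=> M0 g0 gM; have [||C C0 gC] := @eventually_le_bound g e N M^-1.
- by case.
- by move=> n Nn n0; rewrite -ler_pdivrMl ?invr_gt0// invrK gM.
by exists C^-1; [rewrite invr_gt0|move=> n n0; rewrite ler_pdivrMl// gC].
Qed.

Lemma recursion_lower_nu :
  exists2 C, 0 < C & forall n, (0 < n)%N -> C * n%:R `^ (- nu) <= e n.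
Proof.
(* The first entry is a lower bound for [e 1]; the second makes the noise c^2 p^2 V outweigh the
   loss 2 c p (C p) in the induction step. *)
exists (Num.min (c ^+ 2 * V) (c * V / 2)).
  by rewrite lt_min !mulr_gt0// exprn_gt0.
set C := Num.min _ _.
have C0 : 0 < C by rewrite lt_min !mulr_gt0// exprn_gt0.
case=> // n _; elim: n => [|n IHn].
  rewrite powR1 mulr1 eS /p powR1 mulr1.
  apply: (@le_trans _ _ (c ^+ 2 * V)); first by rewrite ge_min lexx.
  by rewrite lerDr mulr_ge0// sqr_ge0.
rewrite -/(p n.+2) in IHn *; rewrite -/(p n.+1) in IHn.
have pp : p n.+2 <= p n.+1.
  by apply: powRN_nonincreasing; rewrite ?ltr0n// ?ler_nat// ltW.
have Cc : C <= c * V / 2 by rewrite ge_min lexx orbT.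
rewrite eS; move: (p_gt0 n.+1) => p2.
have h1 : (1 - c * p n.+2) ^+ 2 * (C * p n.+2) <= (1 - c * p n.+2) ^+ 2 * e n.+1.
  rewrite ler_wpM2l ?sqr_ge0//; apply: le_trans IHn.
  by rewrite ler_pM2l.
apply: le_trans (lerD h1 (lexx _)).
have h2 : 0 <= c * (p n.+2) ^+ 2 * (c * V - 2 * C).
  by rewrite mulr_ge0//; [rewrite mulr_ge0// ?sqr_ge0 ?ltW|lra].
have h3 : 0 <= c ^+ 2 * p n.+2 ^+ 3 * C.
  by rewrite !mulr_ge0 ?sqr_ge0// ?exprn_ge0 ?ltW.
rewrite -subr_ge0 (_ : _ - _ = c * (p n.+2) ^+ 2 * (c * V - 2 * C)
   + c ^+ 2 * p n.+2 ^+ 3 * C); first exact: addr_ge0.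
by ring.
Qed.

(** The noise is dropped and only the contraction kept: by Bernoulli with exponent c <= 1, each
    factor 1 - c/(n+1) is at least (n/(n+1))^c, and the product of the squares telescopes to
    n^(-2c). *)
Lemma recursion_lower_1 : nu = 1 -> c <= 1 ->
  exists2 C, 0 < C & forall n, (0 < n)%N -> C * n%:R `^ (- (2 * c)) <= e n.
Proof.
(* Starting at 1 matters: [e 0] may vanish, whereas the first noise term makes [e 1] positive. *)
move=> nu1 c1; exists (e 1) => //; case=> // n _; elim: n => [|n IHn].
  by rewrite powR1 mulr1.
have n10 : (0 : R) < n.+1%:R by rewrite ltr0n.
have n20 : (0 : R) < n.+2%:R by rewrite ltr0n.
have pE : p n.+2 = n.+2%:R^-1 by rewrite /p nu1 powR_inv1// ltW.
have xE : 1 + - p n.+2 = n.+1%:R / n.+2%:R by rewrite pE subr1_invS.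
have B : (n.+1%:R / n.+2%:R) `^ c <= 1 - c * p n.+2.
  rewrite -xE -mulrN; apply: powR_bernoulli; first by rewrite ltW.
  have : 0 < 1 + - p n.+2 by rewrite xE divr_gt0.
  by have := p_gt0 n.+1; lra.
rewrite (eS n.+1); apply: ler_wpDr; first by rewrite mulr_ge0 ?sqr_ge0// ltW.
apply: (le_trans _ (ler_wpM2l (sqr_ge0 (1 - c * p n.+2)) IHn)).
rewrite mulrCA ler_pM2l//.
have -> : n.+2%:R `^ (- (2 * c)) =
    ((n.+1%:R / n.+2%:R) `^ c) ^+ 2 * n.+1%:R `^ (- (2 * c)) :> R.
  rewrite -powR_mulrn ?powR_ge0// -powRrM [c * _]mulrC.
  rewrite powRM ?invr_ge0 ?(ltW n10) ?(ltW n20)// -(@powR_inv1 _ n.+2%:R) ?ltW//.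
  by rewrite -powRrM mulN1r mulrAC (powRN n.+1%:R) mulfV ?mul1r// gt_eqF// powR_gt0.
by rewrite ler_wpM2r ?powR_ge0// lerXn2r// ?nnegrE ?powR_ge0// (le_trans _ B)// powR_ge0.
Qed.

Lemma recursion_lower_const : 1 < nu ->
  exists2 C, 0 < C & forall n, (0 < n)%N -> C <= e n.
Proof.
move=> nu1; pose s := nu - 1; have s0 : 0 < s by rewrite subr_gt0.
(* Chosen so that K s = 4 c; then [powRN_decrement] makes [g] drop by at least 4 a at each step,
   with a = c p. *)
pose K := 4 * c / s; have K0 : 0 < K by rewrite divr_gt0// mulr_gt0.
have [N HN] := powRN_cvg0 s0 (etrans (invr_gt0 K) K0).
pose g n : R := 1 + K * n%:R `^ (- s).
have g2 n : (N <= n)%N -> (0 < n)%N -> g n <= 2.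
  move=> Nn n0; have := HN _ Nn n0.
  by rewrite -(ler_pM2l K0) mulfV ?gt_eqF// /g; lra.
have gS n : (0 < n)%N -> 4 * (c * p n.+1) <= g n - g n.+1.
  move=> n0; have := powRN_decrement s0 n0.
  rewrite -(ler_pM2l K0) /g (mulrA K s) (_ : K * s = 4 * c); last first.
    by rewrite /K divfK// gt_eqF.
  by rewrite /s subrK -/(p n.+1); lra.
(* Since g <= 2 from N on, this constant starts the induction at N+1, where [e] is surely
   positive. *)
pose M := e N.+1 / 2; have M0 : 0 < M by rewrite divr_gt0.
have eg n : (N < n)%N -> M * g n <= e n.
  elim: n => // n IHn; rewrite ltnS leq_eqVlt => /orP[/eqP <-|Nn].
    by have := g2 N.+1 (leqnSn _) isT; rewrite /M; have := e_gt0 N; nra.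
  have n0 : (0 < n)%N by exact: leq_ltn_trans Nn.
  have := IHn Nn; have := gS _ n0; have := g2 _ (ltnW Nn) n0.
  rewrite eS; have := p_gt0 n; set a := c * p n.+1 => pn gn2 gn eMg.
  have a0 : 0 < a by rewrite mulr_gt0.
  have h1 : (1 - a) ^+ 2 * (M * g n) <= (1 - a) ^+ 2 * e n.
    by rewrite ler_wpM2l ?sqr_ge0.
  have g0 : 0 <= g n by rewrite addr_ge0// mulr_ge0 ?powR_ge0// ltW.
  (* As g n <= 2, (1 - a)^2 g n >= (1 - 2 a) g n >= g n - 4 a >= g (n+1), so [g] is a subsolution of
     the noiseless recursion. *)
  have h2 : M * g n.+1 <= M * ((1 - a) ^+ 2 * g n).
    rewrite ler_pM2l//; apply: (@le_trans _ _ ((1 - 2 * a) * g n)); first by nra.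
    by rewrite ler_wpM2r//; nra.
  have h3 : 0 <= a ^+ 2 * V by rewrite mulr_ge0 ?sqr_ge0// ltW.
  by lra.
have [||C C0 gC] := @eventually_ge_bound (cst 1) N.+1 M M0; first by [].
  move=> n Nn n0; apply: le_trans (eg _ Nn).
  by rewrite ler_pM2l// lerDl mulr_ge0 ?powR_ge0// ltW.
by exists C => // n /gC; rewrite /= mulr1.
Qed.

(** Once a = c p is at most 1, (1 - a)^2 + a^2 = 1 - 2 a (1 - a) <= 1, so any common bound of [e n]
    and V is preserved. *)
Lemma recursion_upper_const :
  exists2 C, 0 < C & forall n, (0 < n)%N -> e n <= C.
Proof.
have [N HN] := powRN_cvg0 nu0 (etrans (invr_gt0 c) c0).
pose M := Num.max (e N) V.
have eM n : (N <= n)%N -> e n <= M.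
  elim: n => [|n IHn].
    by rewrite leqn0 => /eqP N0; rewrite /M N0 le_max lexx.
  rewrite leq_eqVlt => /orP[/eqP <-|]; first by rewrite le_max lexx.
  rewrite ltnS => Nn; rewrite eS.
  have : c * p n.+1 <= 1 by rewrite -ler_pdivlMl// mulr1 HN// leqW.
  have := IHn Nn; have : V <= M by rewrite le_max lexx orbT.
  have := p_gt0 n; set a := c * _ => pn VM eM a1.
  have a0 : 0 < a by rewrite mulr_gt0.
  have h1 : (1 - a) ^+ 2 * e n <= (1 - a) ^+ 2 * M by rewrite ler_wpM2l ?sqr_ge0.
  have h2 : a ^+ 2 * V <= a ^+ 2 * M by rewrite ler_wpM2l ?sqr_ge0.
  have M0 : 0 < M by exact: lt_le_trans VM.
  have h3 : 0 <= (2 * a) * ((1 - a) * M).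
    by apply: mulr_ge0; [lra|apply: mulr_ge0; lra].
  by lra.
have [||C C0 gC] := @eventually_le_bound e (cst 1) N M; first by [].
  by move=> n Nn n0; rewrite mulr1 eM.
by exists C => // n /gC; rewrite /= mulr1.
Qed.

(** The induction shared by nu < 1 and nu = 1. Here 1 + kappa p bounds the ratio of consecutive
    values of n^(-q), and kappa < 2 c says that the contraction (1 - c p)^2 beats this growth to
    first order. *)
Lemma recursion_upper_ratio (q kappa : R) N0 : 0 < q <= nu -> q <= 1 ->
  0 < kappa < 2 * c ->
  (forall n, (N0 <= n)%N -> (0 < n)%N -> q / n%:R <= kappa * p n.+1) ->
  exists2 C, 0 < C & forall n, (0 < n)%N -> e n <= C * n%:R `^ (- q).
Proof.
move=> /andP[q0 qnu] q1 /andP[k0 kc] Hk.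
(* Half of the first-order margin; the other half absorbs the higher-order terms as soon as c^2 (1 +
   kappa) p <= delta, which fixes [N1]. *)
pose delta := (2 * c - kappa) / 2.
have d0 : 0 < delta by rewrite divr_gt0// subr_gt0.
have c2 : 0 < c ^+ 2 * (1 + kappa).
  by rewrite mulr_gt0 ?exprn_gt0// addr_gt0.
have [N1 HN1] := powRN_cvg0 nu0 (divr_gt0 d0 c2).
pose N := (maxn N0 N1).+1.
(* The first entry starts the induction at N; the second pays for the noise through c^2 V <= M
   delta. *)
pose M := Num.max (e N / N%:R `^ (- q)) (c ^+ 2 * V / delta).
have M0 : 0 < M by rewrite lt_max orbC divr_gt0// mulr_gt0// exprn_gt0.
apply: (@eventually_le_bound e (fun n => n%:R `^ (- q)) N M) => /=.
  by move=> n n0; rewrite powR_gt0 ?ltr0n.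
elim=> [|n IHn]; first by [].
rewrite leq_eqVlt => /orP[/eqP <- _|].
  rewrite -[leLHS](@divfK _ (N%:R `^ (- q))) ?gt_eqF ?powR_gt0 ?ltr0n//.
  by rewrite ler_pM2r ?powR_gt0 ?ltr0n// le_max lexx.
rewrite ltnS => Nn _.
have n0 : (0 < n)%N by exact: leq_trans Nn.
have {}IHn := IHn Nn n0.
have N0n : (N0 <= n)%N by apply: leq_trans (ltnW Nn); rewrite leq_maxl.
have N1n : (N1 <= n.+1)%N by apply: leqW; apply: leq_trans (ltnW Nn); rewrite leq_maxr.
have {}Hk := Hk n N0n n0.
have := HN1 _ N1n isT; rewrite -/(p n.+1) ler_pdivlMr// => Hp.
have Hq : n%:R `^ (- q) <= n.+1%:R `^ (- q) * (1 + q / n%:R).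
  have n0' : (0 : R) < n%:R by rewrite ltr0n.
  have -> : n%:R `^ (- q) = n.+1%:R `^ (- q) * (n.+1%:R / n%:R) `^ q :> R.
    rewrite powRM ?ler0n ?invr_ge0 ?ler0n// mulrA -powRD ?pnatr_eq0 ?implybT//.
    rewrite addNr powRr0 mul1r -[_^-1]powR_inv1 ?ler0n// -powRrM mulN1r//.
  rewrite ler_wpM2l ?powR_ge0// -natr1 mulrDl divff ?gt_eqF// mul1r.
  by apply: powR_bernoulli; [rewrite ltW|rewrite (lt_trans (ltrN10 R))// invr_gt0].
have pq : p n.+1 <= n.+1%:R `^ (- q) by exact: powRN_exponent_anti.
have := p_gt0 n; have := p_le1 n; rewrite eS.
set P := p n.+1 in Hk Hp pq *; set G := n.+1%:R `^ (- q) in pq Hq *.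
move=> P1 P0.
have G0 : 0 < G by rewrite powR_gt0 ?ltr0n.
have h1 : (1 - c * P) ^+ 2 * e n <= (1 - c * P) ^+ 2 * (M * (G * (1 + kappa * P))).
  rewrite ler_wpM2l ?sqr_ge0//; apply: le_trans IHn _; rewrite ler_pM2l//.
  by apply: le_trans Hq _; rewrite ler_pM2l// lerD2l.
have h2 : (1 - c * P) ^+ 2 * (1 + kappa * P) <= 1 - delta * P.
  have : 0 <= P * (delta - P * (c ^+ 2 * (1 + kappa))).
    by rewrite mulr_ge0 ?(ltW P0)// subr_ge0.
  have : 0 <= c * kappa * P ^+ 2 by rewrite !mulr_ge0 ?exprn_ge0 ?ltW.
  have : 0 <= c ^+ 2 * kappa * P ^+ 2 * (1 - P).
    by rewrite mulr_ge0 ?subr_ge0// !mulr_ge0 ?exprn_ge0 ?ltW.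
  by rewrite /delta; lra.
have h3 : c ^+ 2 * V <= M * delta.
  by rewrite -ler_pdivrMr// le_max lexx orbT.
have h4 : (1 - c * P) ^+ 2 * (M * (G * (1 + kappa * P))) <= M * G * (1 - delta * P).
  rewrite [leLHS](_ : _ = M * G * ((1 - c * P) ^+ 2 * (1 + kappa * P))); last by ring.
  by rewrite ler_pM2l// mulr_gt0.
(* The noise is quadratic in P; P <= G, a consequence of q <= nu, turns one factor P into G. *)
have h5 : (c * P) ^+ 2 * V <= M * delta * (P * G).
  rewrite [leLHS](_ : _ = c ^+ 2 * V * (P * P)); last by ring.
  apply: ler_pM => //; last by rewrite ler_pM2l.
    by rewrite mulr_ge0 ?sqr_ge0 ?(ltW V0).
  by rewrite mulr_ge0 ?(ltW P0).
apply: le_trans (lerD (le_trans h1 h4) h5) _.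
by rewrite le_eqVlt; apply/orP; left; apply/eqP; ring.
Qed.

Lemma recursion_upper_nu : nu < 1 ->
  exists2 C, 0 < C & forall n, (0 < n)%N -> e n <= C * n%:R `^ (- nu).
Proof.
move=> nu1.
have nu1' : 0 < 1 - nu by rewrite subr_gt0.
(* With kappa = c the ratio condition is nu/n <= c (n+1)^(-nu). The factor 2 pays for 1/n <=
   2/(n+1), leaving (n+1)^(nu-1) <= c/(2 nu). *)
have eta0 : 0 < c / (2 * nu) by rewrite divr_gt0// mulr_gt0.
have [N HN] := powRN_cvg0 nu1' eta0.
apply: (@recursion_upper_ratio nu c N).
- by rewrite nu0 lexx.
- exact: ltW.
- by rewrite c0 mulr_natl mulr2n ltrDl.
move=> n Nn n0; have := HN _ (leqW Nn) isT.
have n0' : (1 : R) <= n%:R by rewrite ler1n.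
have n1E : n.+1%:R `^ (- (1 - nu)) = n.+1%:R^-1 / p n.+1.
  rewrite opprB powRB ?pnatr_eq0 ?implybT//.
  by rewrite /p powRN invrK powRr1 ?ler0n// mulrC.
rewrite n1E ler_pdivrMr// => h.
have h' : n%:R^-1 <= 2 * n.+1%:R^-1 :> R.
  rewrite ler_pdivlMr ?ltr0n// ler_pdivrMl ?(lt_le_trans ltr01)//.
  by rewrite -natr1 mulrC mulr_natl mulr2n lerD2l.
apply: (@le_trans _ _ (nu * (2 * n.+1%:R^-1))); first by rewrite ler_pM2l.
rewrite mulrA [nu * 2]mulrC -ler_pdivlMl ?mulr_gt0//.
by rewrite mulrA [_^-1 * c]mulrC.
Qed.

Lemma recursion_upper_1 (q : R) : nu = 1 -> 0 < q <= 1 -> q < 2 * c ->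
  exists2 C, 0 < C & forall n, (0 < n)%N -> e n <= C * n%:R `^ (- q).
Proof.
move=> nu1 /andP[q0 q1] qc.
(* The midpoint lies strictly between q and 2 c. The ratio condition q/n <= kappa/(n+1) then amounts
   to n >= q/(kappa - q), the threshold used below. *)
pose kappa := (q + 2 * c) / 2.
have kq : 0 < kappa - q by rewrite /kappa; lra.
have qk0 : 0 <= q / (kappa - q) by rewrite divr_ge0// ltW.
apply: (@recursion_upper_ratio q kappa (Num.bound (q / (kappa - q)))) => //.
- by rewrite q0 nu1.
- by apply/andP; rewrite /kappa; split; lra.
- move=> n Nn n0.
  have : q / (kappa - q) <= n%:R.
    apply: ltW; apply: lt_le_trans (archi_boundP qk0) _.
    by rewrite ler_nat.
  rewrite ler_pdivrMr// => h.
  rewrite /p nu1 powR_inv1 ?ler0n// ler_pdivrMr ?ltr0n//.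
  rewrite mulrAC ler_pdivlMr ?ltr0n// -natr1; lra.
Qed.

End sgd_recursion.

(** The exponents are doubled because [e] stands for a squared error. *)
Lemma recursion_rate (R : realType) (alpha gamma nu V eps : R) (e : nat -> R) :
  0 < alpha -> 0 < gamma -> 0 < nu -> 0 < V -> 0 <= e 0 -> 0 < eps ->
  (forall n, e n.+1 = (1 - gamma * alpha * n.+1%:R `^ (- nu)) ^+ 2 * e n +
                      (gamma * alpha * n.+1%:R `^ (- nu)) ^+ 2 * V) ->
  exists C0 C1, [/\ 0 < C0, 0 < C1 & forall n, (0 < n)%N ->
    C0 * n%:R `^ (- (2 * rate alpha gamma nu eps 0)) <= e n <=
    C1 * n%:R `^ (- (2 * rate alpha gamma nu eps 1))].
Proof.
move=> a0 g0 nu0 V0 e0 eps0 eS.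
have c0 : 0 < gamma * alpha by rewrite mulr_gt0.
suff [[C0 C00 HC0] [C1 C10 HC1]] :
    (exists2 C, 0 < C & forall n, (0 < n)%N ->
       C * n%:R `^ (- (2 * rate alpha gamma nu eps 0)) <= e n) /\
    (exists2 C, 0 < C & forall n, (0 < n)%N ->
       e n <= C * n%:R `^ (- (2 * rate alpha gamma nu eps 1))).
  by exists C0, C1; split => // n n0; rewrite HC0//= HC1.
rewrite /rate expr0 expr1 mulN1r (mul1r eps).
have [nu1|nu1|nu1] := ltgtP nu 1.
- have -> : 2 * (nu / 2) = nu by rewrite mulrC divfK.
  split; first exact: recursion_lower_nu c0 nu0 V0 e0 eS.
  exact: recursion_upper_nu c0 nu0 V0 eS nu1.
- rewrite mulr0 oppr0.
  have [C C_gt0 HC] := recursion_lower_const c0 V0 e0 eS nu1.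
  have [D D_gt0 HD] := recursion_upper_const c0 nu0 V0 eS.
  split; [exists C => // n n0|exists D => // n n0]; rewrite powRr0 mulr1.
    exact: HC.
  exact: HD.
- set c := gamma * alpha in c0 eS *; split.
    have [ceps|ceps] := leP (1 / 2) (c + eps).
      rewrite (_ : 2 * (1 / 2) = nu); last by rewrite nu1 mul1r divff.
      exact: recursion_lower_nu c0 nu0 V0 e0 eS.
    (* Here c + eps < 1/2, so the contraction-only bound applies, and n^(-2c) exceeds the required
       n^(-2(c + eps)). *)
    have c1 : c <= 1 by lra.
    have [C C_gt0 HC] := recursion_lower_1 c0 V0 e0 eS nu1 c1.
    exists C => // n n0; apply: le_trans (HC n n0).
    by rewrite ler_pM2l// powRN_exponent_anti//; lra.
  set q := 2 * _.
  have q1 : q <= 1.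
    have : Num.min (1 / 2) (c - eps) <= 1 / 2 by rewrite ge_min lexx.
    by rewrite /q; lra.
  have qc : q < 2 * c.
    have : Num.min (1 / 2) (c - eps) <= c - eps by rewrite ge_min lexx orbT.
    by rewrite /q; lra.
  have [q0|q0] := ltP 0 q.
    by apply: (recursion_upper_1 c0 nu0 V0 eS nu1) => //; rewrite q0.
  (* For c <= eps the exponent q is nonpositive, so n^(-q) >= 1 and boundedness suffices. *)
  have [D D_gt0 HD] := recursion_upper_const c0 nu0 V0 eS.
  exists D => // n n0; apply: le_trans (HD n n0) _.
  rewrite ler_peMr ?(ltW D_gt0)//.
  by rewrite -[leLHS](powRr0 n%:R) ler_powR ?ler1n// oppr_ge0.
Qed.

(** * Square-integrable random variables *)

Section independence.
Context {disp : measure_display} {Omega : measurableType disp} {R : realType}.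
Variable P : probability Omega R.

Lemma expectation_independentM (X Y : Omega -> R) :
  X \in Lfun P 1 -> Y \in Lfun P 1 -> (X \* Y) \in Lfun P 1 ->
  (forall A B : set R, measurable A -> measurable B ->
    (P (X @^-1` A `&` Y @^-1` B) = P (X @^-1` A) * P (Y @^-1` B))%E) ->
  ('E_P[X \* Y] = 'E_P[X] * 'E_P[Y])%E.
Proof.
move=> /Lfun1_integrable iX /Lfun1_integrable iY /Lfun1_integrable iXY indXY.
have mX : measurable_fun setT X by exact/measurable_EFinP/(measurable_int P).
have mY : measurable_fun setT Y by exact/measurable_EFinP/(measurable_int P).
pose Xm : {mfun Omega >-> R} := HB.pack X (isMeasurableFun.Build _ _ _ _ X mX).
pose Ym : {mfun Omega >-> R} := HB.pack Y (isMeasurableFun.Build _ _ _ _ Y mY).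
pose Z w := (X w, Y w).
have mZ : measurable_fun setT Z by exact: measurable_fun_pair.
pose Zm : {mfun Omega >-> (R * R)%type} :=
  HB.pack Z (isMeasurableFun.Build _ _ _ _ Z mZ).
pose f (z : R * R) : \bar R := (z.1 * z.2)%:E.
have mf : measurable_fun setT f.
  by apply/measurable_EFinP; apply: measurable_funM.
pose dX := distribution P Xm; pose dY := distribution P Ym.
(* Independence on rectangles determines the joint law: it is the product of the marginals, so
   Fubini applies to (x, y) -> x y. *)
have eqm (A : set (R * R)) : measurable A -> (dX \x dY)%E A = distribution P Zm A.
  by move=> mA; apply: (@product_measure_unique _ _ _ _ _ dX dY).
have iZ : (distribution P Zm).-integrable setT f.
  by apply: integrable_pushforward.
have iprod : (dX \x dY)%E.-integrable setT f.
  apply/integrableP; split=> //.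
  rewrite (@eq_measure_integral _ _ _ _ (distribution P Zm)).
    by have /integrableP[] := iZ.
  by move=> A mA _; exact: eqm.
have iid' : dY.-integrable setT (EFin : R -> \bar R).
  by apply: integrable_pushforward => //; exact/measurable_EFinP.
rewrite unlock.
transitivity (\int[distribution P Zm]_z f z)%E.
  by rewrite integral_distribution.
rewrite (@eq_measure_integral _ _ _ _ (dX \x dY)%E); last first.
  by move=> A mA _; exact/esym/eqm.
rewrite -integral12_prod_meas1//.
have EY : (\int[dY]_y y%:E = \int[P]_w (Y w)%:E)%E.
  by rewrite integral_distribution//; exact/measurable_EFinP.
transitivity (\int[dX]_x (x%:E * \int[P]_w (Y w)%:E))%E.
  apply: eq_integral => x _; rewrite -EY /fubini_F -integralZl//.
have EYfin : (\int[P]_w (Y w)%:E)%E \is a fin_num by exact: integrable_fin_num.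
rewrite -(fineK EYfin) integralZr//; last first.
  by apply: integrable_pushforward => //; exact/measurable_EFinP.
by rewrite integral_distribution//; exact/measurable_EFinP.
Qed.

End independence.

Section square_integrable.
Context {disp : measure_display} {Omega : measurableType disp} {R : realType}.
Variable P : probability Omega R.
Implicit Types f g : Omega -> R.

Lemma Lfun2_Lfun1 f : f \in Lfun P 2%:E -> f \in Lfun P 1.
Proof. by apply: Lfun_subset12; exact: fin_num_measure. Qed.

Lemma Lfun2P f : measurable_fun setT f ->
  ('E_P[fun w => (f w ^+ 2)%R] < +oo)%E -> f \in Lfun P 2%:E.
Proof.
move=> mf foo; rewrite inE; apply/andP; split; rewrite inE//=.
rewrite /finite_norm unlock /Lnorm poweR_lty//.
move: foo; rewrite unlock; apply: le_lt_trans.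
rewrite le_eqVlt; apply/orP; left; apply/eqP; apply: eq_integral => w _.
by rewrite /= powR_mulrn// real_normK// num_real.
Qed.

Lemma Lfun_lincomb (r : R) f g a b : 1 <= r ->
  f \in Lfun P r%:E -> g \in Lfun P r%:E ->
  (fun w => a * f w + b * g w) \in Lfun P r%:E.
Proof.
move=> r1 fr gr.
rewrite (_ : (fun _ => _) = (a \o* f) \+ (b \o* g)); last first.
  by apply/funext => w /=; rewrite [a * _]mulrC [b * _]mulrC.
by apply: rpredD; exact: Lfun_scale.
Qed.

Lemma Lfun2_subr_cst f c : f \in Lfun P 2%:E ->
  (fun w => f w - c) \in Lfun P 2%:E.
Proof.
move=> f2; have -> : (fun w => f w - c) = (fun w => 1 * f w + - c * cst 1 w).
  by apply/funext => w /=; rewrite mul1r mulr1.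
by apply: Lfun_lincomb; rewrite ?ler1n// Lfun_cst.
Qed.

Lemma Lfun2_sqr f : f \in Lfun P 2%:E -> (fun w => f w ^+ 2) \in Lfun P 1.
Proof. by move=> f2; exact: (Lfun2_mul_Lfun1 f2 f2). Qed.

Lemma expectation_lincomb f g a b : f \in Lfun P 1 -> g \in Lfun P 1 ->
  ('E_P[fun w => (a * f w + b * g w)%R] = a%:E * 'E_P[f] + b%:E * 'E_P[g])%E.
Proof.
move=> f1 g1; rewrite -!expectationZl// -expectationD ?Lfun_scale//.
by congr expectation; apply/funext => w /=; rewrite [a * _]mulrC [b * _]mulrC.
Qed.

Lemma expectation_sum_ord d (F : 'I_d -> Omega -> R) :
  (forall i, F i \in Lfun P 1) ->
  ('E_P[fun w => (\sum_(i < d) F i w)%R] = \sum_(i < d) 'E_P[F i])%E.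
Proof.
move=> F1; rewrite unlock.
under eq_integral do rewrite -sumEFin.
by rewrite integral_sum// => i; exact/Lfun1_integrable.
Qed.

(** Both sides are integrals of [h] against the same law. The nonnegative alternative is available
    before integrability is known and carries second moments from [X 1] to [X n]; the integrable one
    then serves the means. *)
Lemma identically_distributed_expectation f g (h : R -> R) :
  measurable_fun setT f -> measurable_fun setT g -> measurable_fun setT h ->
  (forall A : set R, measurable A -> P (f @^-1` A) = P (g @^-1` A)) ->
  (forall x, 0 <= h x) \/ (h \o f \in Lfun P 1 /\ h \o g \in Lfun P 1) ->
  ('E_P[h \o f] = 'E_P[h \o g])%E.
Proof.
move=> mf mg mh fg H.
pose fm : {mfun Omega >-> R} := HB.pack f (isMeasurableFun.Build _ _ _ _ f mf).
pose gm : {mfun Omega >-> R} := HB.pack g (isMeasurableFun.Build _ _ _ _ g mg).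
have mh' : measurable_fun setT (EFin \o h) by exact/measurable_EFinP.
have E : (\int[distribution P fm]_x (h x)%:E =
          \int[distribution P gm]_x (h x)%:E)%E.
  by apply: eq_measure_integral => A mA _; exact: fg.
rewrite unlock; case: H => [h0|[/Lfun1_integrable hf /Lfun1_integrable hg]].
  have h0' y : (0 <= (EFin \o h) y)%E by rewrite lee_fin.
  have := ge0_integral_distribution fm mh' h0'.
  have := ge0_integral_distribution gm mh' h0'.
  by move=> /= <- <-.
have := integral_distribution (X := fm) mh' hf.
have := integral_distribution (X := gm) mh' hg.
by move=> /= <- <-.
Qed.

End square_integrable.

(** * Averaging with uncorrelated centred noise in one coordinate *)

Section averaging_recursion.
Context {disp : measure_display} {Omega : measurableType disp} {R : realType}.
Variable P : probability Omega R.
Variables (Z T : nat -> Omega -> R) (a : nat -> R) (v t0 : R).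
Hypothesis Z2 : forall n, (0 < n)%N -> Z n \in Lfun P 2%:E.
Hypothesis EZ : forall n, (0 < n)%N -> ('E_P[Z n] = 0)%E.
Hypothesis EZsqr : forall n, (0 < n)%N -> ('E_P[fun w => (Z n w ^+ 2)%R] = v%:E)%E.
Hypothesis EZZ : forall i j, (0 < i)%N -> (0 < j)%N -> i != j ->
  ('E_P[Z i \* Z j] = 0)%E.
Hypothesis T_0 : forall w, T 0 w = t0.
Hypothesis T_S : forall n w,
  T n.+1 w = (1 - a n.+1) * T n w + a n.+1 * Z n.+1 w.

Lemma averaging_Lfun2 n : T n \in Lfun P 2%:E.
Proof.
elim: n => [|n IHn].
  by rewrite (_ : T 0 = cst t0) ?Lfun_cst//; apply/funext => w; rewrite T_0.
rewrite (funext (T_S n)); by apply: Lfun_lincomb; rewrite ?ler1n// Z2.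
Qed.

(* T n is a linear combination of a constant and Z 1, ..., Z n. *)
Let averaging_uncorrelated n j : (n < j)%N -> ('E_P[T n \* Z j] = 0)%E.
Proof.
elim: n => [|n IHn] nj.
  rewrite (_ : T 0 \* Z j = t0 \o* Z j); last first.
    by apply/funext => w /=; rewrite T_0 mulrC.
  by rewrite expectationZl ?EZ ?mule0// Lfun2_Lfun1// Z2.
have j0 : (0 < j)%N by exact: leq_trans nj.
rewrite (_ : T n.+1 \* Z j = fun w => (1 - a n.+1) * (T n \* Z j) w
    + a n.+1 * (Z n.+1 \* Z j) w); last first.
  by apply/funext => w /=; rewrite T_S; ring.
rewrite expectation_lincomb ?Lfun2_mul_Lfun1 ?averaging_Lfun2 ?Z2//.
by rewrite IHn ?(ltnW nj)// EZZ// ?mule0 ?adde0// neq_ltn nj.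
Qed.

(** Expanding the square leaves a cross term proportional to E[T_n Z_(n+1)], which vanishes because
    T_n involves only earlier noise. *)
Lemma averaging_second_moment n :
  fine ('E_P[fun w => (T n.+1 w ^+ 2)%R])%E =
  (1 - a n.+1) ^+ 2 * fine ('E_P[fun w => (T n w ^+ 2)%R])%E + a n.+1 ^+ 2 * v.
Proof.
have T2 := averaging_Lfun2 n; have Zn2 := Z2 (ltn0Sn n).
rewrite (_ : (fun w => T n.+1 w ^+ 2) = fun w =>
    1 * ((1 - a n.+1) ^+ 2 * T n w ^+ 2 + a n.+1 ^+ 2 * Z n.+1 w ^+ 2) +
    2 * (1 - a n.+1) * a n.+1 * (T n \* Z n.+1) w); last first.
  by apply/funext => w /=; rewrite T_S; ring.
have sq1 : (fun w => (1 - a n.+1) ^+ 2 * T n w ^+ 2 + a n.+1 ^+ 2 * Z n.+1 w ^+ 2)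
    \in Lfun P 1.
  by apply: Lfun_lincomb => //; exact: Lfun2_sqr.
rewrite expectation_lincomb ?Lfun2_mul_Lfun1// averaging_uncorrelated// mule0 adde0 mul1e.
rewrite expectation_lincomb ?Lfun2_sqr// EZsqr//.
have /expectation_fin_num/fineK <- := Lfun2_sqr T2.
by rewrite -!EFinM -EFinD.
Qed.

End averaging_recursion.

(** * Euclidean geometry and random vectors *)

Section euclidean.
Context {R : realType} {d : nat}.
Implicit Types u v x t : 'rV[R]_d.

Lemma dotp_ge0 u : 0 <= dotp u u.
Proof. by apply: sumr_ge0 => i _; rewrite -expr2 sqr_ge0. Qed.

Lemma enorm_sqr u : enorm u ^+ 2 = \sum_(i < d) u 0 i ^+ 2.
Proof. by rewrite sqr_sqrtr ?dotp_ge0//; apply: eq_bigr => i _; rewrite expr2. Qed.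

Lemma subrVE u v i : (u - v) 0 i = u 0 i - v 0 i.
Proof. by rewrite !mxE. Qed.

Lemma enorm_sqrB u v : enorm (u - v) ^+ 2 = \sum_(i < d) (u 0 i - v 0 i) ^+ 2.
Proof. by rewrite enorm_sqr; apply: eq_bigr => i _; rewrite subrVE. Qed.

Lemma dotpE u : dotp u u = enorm u ^+ 2.
Proof. by rewrite sqr_sqrtr ?dotp_ge0. Qed.

Lemma enorm_sqr_eq0 u : enorm u ^+ 2 = 0 -> u = 0.
Proof.
rewrite enorm_sqr => /eqP; rewrite psumr_eq0; last by move=> i _; exact: sqr_ge0.
move=> /allP u0; apply/rowP => i; rewrite mxE.
by apply/eqP; rewrite -sqrf_eq0; apply: u0; rewrite mem_index_enum.
Qed.

Lemma enorm_sqrB_eq0 u v : enorm (u - v) ^+ 2 = 0 <-> u = v.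
Proof.
split=> [/enorm_sqr_eq0/eqP|->]; first by rewrite subr_eq0 => /eqP.
by rewrite subrr enorm_sqr big1// => i _; rewrite mxE expr0n.
Qed.

Lemma dotpZr (a : R) u v : dotp u (a *: v) = a * dotp u v.
Proof.
by rewrite /dotp big_distrr; apply: eq_bigr => i _; rewrite mxE mulrCA.
Qed.

Lemma enormZ (a : R) u : 0 <= a -> enorm (a *: u) = a * enorm u.
Proof.
move=> a0; rewrite /enorm -[in RHS](ger0_norm a0) -sqrtr_sqr -sqrtrM ?sqr_ge0//.
congr Num.sqrt; rewrite /dotp big_distrr; apply: eq_bigr => i _ /=.
by rewrite !mxE; ring.
Qed.

Lemma enormN u : enorm (- u) = enorm u.
Proof.
by rewrite /enorm /dotp; congr Num.sqrt; apply: eq_bigr => i _; rewrite !mxE mulrNN.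
Qed.

Variables (alpha K : R) (x : 'rV[R]_d).
Let q t := alpha / 2 * enorm (t - x) ^+ 2 + K.

(** The constant [K] lets one computation serve both F(., x), with K = 0, and f, with K the variance
    term. *)
Lemma gradient_quadratic t : gradient q t = alpha *: (t - x).
Proof.
apply/rowP => i; rewrite !mxE; apply: cvg_lim => //.
(* For h != 0 this affine function of h is the difference quotient itself: only coordinate i
   survives in the difference of squared norms. *)
have : (fun h : R => alpha * (t 0 i - x 0 i) + h * (alpha / 2)) h
    @[h --> 0^'] --> alpha * (t 0 i - x 0 i) + 0 * (alpha / 2).
  by apply: cvgD; [exact: cvg_cst|apply: cvgMl; exact: cvg_within].
rewrite mul0r addr0; apply: cvg_trans; apply: near_eq_cvg; near=> h.
have h0 : h != 0 by near: h; exact: nbhs_dnbhs_neq.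
rewrite /q opprD addrACA subrr addr0 -mulrBr !enorm_sqr -sumrB.
rewrite (bigD1 i)//= big1 => [|j ji]; rewrite !mxE eqxx/=; last first.
  by rewrite (negbTE ji) mulr0 add0r subrr.
by rewrite /GRing.scale eqxx /= mulr1; field.
Unshelve. all: by end_near. Qed.

Lemma differentiable_quadratic t : differentiable q t.
Proof.
(* The norm is a square root, singular at 0; its square is handled as a polynomial in the
   coordinates. *)
rewrite (_ : q = (alpha / 2) *: (\sum_(i < d)
    (fun u : 'rV[R]_d => u 0 i - x 0 i : R) ^+ 2) + cst K); last first.
  apply/funext => u; rewrite /q enorm_sqr !fctE/= fct_sumE; congr (_ * _ + _).
  by apply: eq_bigr => i _; rewrite !mxE.
apply: differentiableD; last exact: differentiable_cst.
apply: differentiableZ; apply: differentiable_sum => i.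
apply: differentiableX; apply: differentiableB; last exact: differentiable_cst.
exact: differentiable_coord.
Qed.

End euclidean.

(** * Moments and independence of random vectors *)

Section random_vectors.
Context {R : realType} {d : nat} {disp : measure_display}.
Context {Omega : measurableType disp}.
Variable P : probability Omega R.
Implicit Types X : Omega -> 'rV[R]_d.

(** Coordinates are continuous, so preimages of the open intervals generating the Borel sets of R
    are open, hence generators of [borel_rV]. *)
Lemma measurable_coord (k : 'I_d) :
  measurable_fun setT ((fun v => v 0 k) : borel_rV R d -> R).
Proof.
apply: (measurability _ (RGenOpens.measurableE R)).
move=> _ [_ [a [b ->] <-]]; apply: sub_sigma_algebra; rewrite setTI.
exact: (proj1 (continuousP _) (@coord_continuous R 1 d 0 k)) _ (interval_open _ _).
Qed.

Lemma random_vector_coord X k : random_vector X ->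
  measurable_fun setT (fun w => X w 0 k).
Proof. exact: (measurableT_comp (measurable_coord k)). Qed.

Lemma measurable_enorm_sqrB X c : random_vector X ->
  measurable_fun setT (fun w => enorm (X w - c) ^+ 2).
Proof.
move=> mX; rewrite (_ : (fun _ => _) = fun w => \sum_(k < d) (X w 0 k - c 0 k) ^+ 2).
  apply: measurable_sum => k; apply: measurable_funX; apply: measurable_funB => //.
  exact: random_vector_coord.
by apply/funext => w; rewrite enorm_sqrB.
Qed.

Lemma random_vector_coord_Lfun2 X k : random_vector X ->
  ('E_P[fun w => (enorm (X w) ^+ 2)%R] < +oo)%E ->
  (fun w => X w 0 k) \in Lfun P 2%:E.
Proof.
move=> mX Xoo; apply: Lfun2P; first exact: random_vector_coord.
apply: le_lt_trans Xoo; apply: expectation_le.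
- by apply: measurable_funX; exact: random_vector_coord.
- have := measurable_enorm_sqrB 0 mX.
  by under eq_fun do rewrite subr0.
- by move=> w; exact: sqr_ge0.
- by move=> w; exact: sqr_ge0.
- apply: aeW => w; rewrite enorm_sqr (bigD1 k)//= lerDl.
  by apply: sumr_ge0 => i _; exact: sqr_ge0.
Qed.

Lemma enorm_sqr_Lfun1 X : (forall k, (fun w => X w 0 k) \in Lfun P 2%:E) ->
  (fun w => enorm (X w) ^+ 2) \in Lfun P 1.
Proof.
move=> X2; apply/Lfun1_integrable.
have : P.-integrable setT (fun w => \sum_(k < d) ((X w 0 k)%R ^+ 2)%:E)%E.
  by apply: integrable_sum => // k _; exact/Lfun1_integrable/Lfun2_sqr.
by apply: eq_integrable => // w _; rewrite /= enorm_sqr sumEFin.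
Qed.

Lemma expectation_enorm_sqrB X c :
  (forall k, (fun w => X w 0 k) \in Lfun P 2%:E) ->
  ('E_P[fun w => (enorm (X w - c) ^+ 2)%R] =
   \sum_(k < d) 'E_P[fun w => ((X w 0 k - c 0 k) ^+ 2)%R])%E.
Proof.
move=> X2; rewrite -expectation_sum_ord; last first.
  by move=> k; apply: Lfun2_sqr; exact: Lfun2_subr_cst.
by congr expectation; apply/funext => w; rewrite enorm_sqrB.
Qed.

Lemma expectation_centered (Y : Omega -> R) : Y \in Lfun P 1 ->
  ('E_P[fun w => (Y w - fine 'E_P[Y])%R] = 0)%E.
Proof.
move=> Y1.
have -> : (fun w => Y w - fine ('E_P[Y])%E) =
    (fun w => 1 * Y w + - fine ('E_P[Y])%E * cst 1 w).
  by apply/funext => w /=; rewrite mul1r mulr1.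
rewrite expectation_lincomb ?Lfun_cst// expectation_cst mul1e mule1.
by rewrite EFinN fineK ?expectation_fin_num// subee// expectation_fin_num.
Qed.

(** The bias-variance decomposition: the cross term is a multiple of the centred variable Y - m. *)
Lemma expectation_sqr_shift (Y : Omega -> R) t : Y \in Lfun P 2%:E ->
  ('E_P[fun w => ((Y w - t) ^+ 2)%R] = ((t - fine 'E_P[Y]) ^+ 2)%:E +
    'E_P[fun w => ((Y w - fine 'E_P[Y]) ^+ 2)%R])%E.
Proof.
move=> Y2; set m := fine _.
have Ym2 : (fun w => Y w - m) \in Lfun P 2%:E by exact: Lfun2_subr_cst.
have -> : (fun w => (Y w - t) ^+ 2) = (fun w => 1 * (Y w - m) ^+ 2 +
    1 * (2 * (m - t) * (Y w - m) + (t - m) ^+ 2 * cst 1 w)).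
  by apply/funext => w /=; ring.
rewrite expectation_lincomb ?Lfun2_sqr//; last first.
  by apply: (Lfun_lincomb _ _ (lexx 1)); rewrite ?Lfun_cst// Lfun2_Lfun1.
rewrite expectation_lincomb ?Lfun_cst ?Lfun2_Lfun1//.
rewrite expectation_centered ?Lfun2_Lfun1// expectation_cst.
by rewrite !mul1e mule0 add0e mule1 addeC.
Qed.

Lemma expectation_enorm_sqr_shift X t :
  (forall k, (fun w => X w 0 k) \in Lfun P 2%:E) ->
  ('E_P[fun w => (enorm (X w - t) ^+ 2)%R] =
   (enorm (t - mean_vector P X) ^+ 2)%:E +
   'E_P[fun w => (enorm (X w - mean_vector P X) ^+ 2)%R])%E.
Proof.
move=> X2; rewrite !expectation_enorm_sqrB// enorm_sqr -sumEFin -big_split.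
apply: eq_bigr => k _; rewrite expectation_sqr_shift//=.
by rewrite !mxE; congr (_ + 'E_P[_])%E; apply/funext => w; rewrite !mxE.
Qed.

(** A vanishing expectation of a nonnegative variable would force X = c off a null set, hence with
    probability 1. Applied at the mean, this gives V > 0. *)
Lemma expectation_enorm_sqrB_gt0 X c : random_vector X ->
  (P [set w | X w = c] < 1)%E ->
  (0 < 'E_P[fun w => (enorm (X w - c) ^+ 2)%R])%E.
Proof.
move=> mX Xc.
have msq := measurable_enorm_sqrB c mX.
rewrite lt_neqAle expectation_ge0 ?andbT; last by move=> w; exact: sqr_ge0.
apply/negP => /eqP/esym; rewrite unlock => E0.
move: Xc; rewrite ltNge => /negP; apply.
have : ae_eq P setT (fun w => (enorm (X w - c) ^+ 2)%:E) (cst 0%E).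
  apply/ae_eq_integral_abs => //; first exact/measurable_EFinP.
  rewrite -[RHS]E0; apply: eq_integral => w _.
  by rewrite gee0_abs// lee_fin sqr_ge0.
move=> [N [mN N0 sN]].
have <- : P (~` N) = 1%E by rewrite probability_setC// [P N]N0 sube0.
have E : [set w | X w = c] = (fun w => enorm (X w - c) ^+ 2) @^-1` [set 0].
  by apply/seteqP; split => w /=; rewrite enorm_sqrB_eq0.
apply: le_measure; rewrite ?inE.
- exact: measurableC.
- by rewrite E -[X in measurable X]setTI; exact: msq.
- move=> w Nw; rewrite E /=; apply: contrapT => nw; apply: Nw; apply: sN => /=.
  by move=> /(_ I) [].
Qed.

Lemma independent_pair (I : set nat) (X : nat -> Omega -> 'rV[R]_d) i j
    (A B : set (borel_rV R d)) : mutually_independent P I X ->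
  I i -> I j -> i != j -> measurable A -> measurable B ->
  (P (X i @^-1` A `&` X j @^-1` B) = P (X i @^-1` A) * P (X j @^-1` B))%E.
Proof.
move=> indX Ii Ij ij mA mB.
have := indX [:: i; j] (fun n => if n == i then A else B).
rewrite !big_cons big_nil mule1 eqxx eq_sym (negbTE ij) => <-.
- congr (P _); apply/seteqP; split => w /=.
    move=> [wA wB] n /=; rewrite !inE => /orP[|] /eqP ->; first by rewrite eqxx.
    by rewrite eq_sym (negbTE ij).
  move=> wAB; split.
    by have := wAB i; rewrite /= eqxx !inE eqxx; exact.
  by have := wAB j; rewrite /= eq_sym (negbTE ij) !inE eqxx orbT; exact.
- by rewrite /= inE ij.
- by move=> n; rewrite !inE => /orP[|] /eqP ->.
- by move=> n _; case: ifP.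
Qed.

End random_vectors.

(** * The descent process *)

Section stochastic_gradient_descent.
Context {R : realType} {d : nat} {disp : measure_display}.
Context {Omega : measurableType disp}.
Variable P : probability Omega R.
Variable X : nat -> Omega -> 'rV[R]_d.
Hypothesis X_iid : iid P [set n | (0 < n)%N] X.
Hypothesis X_square_integrable :
  ('E_P[fun w => (enorm (X 1 w) ^+ 2)%R] < +oo)%E.
Let m := mean_vector P (X 1).

Let mX n (k : 'I_d) : (0 < n)%N -> measurable_fun setT (fun w => X n w 0 k).
Proof. by case: X_iid => rX _ _ n0; apply: random_vector_coord; exact: rX. Qed.

Let X1_Lfun2 k : (fun w => X 1 w 0 k) \in Lfun P 2%:E.
Proof. by apply: random_vector_coord_Lfun2 => //; case: X_iid => rX _ _; exact: rX. Qed.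

Let X_dist n k (A : set R) : (0 < n)%N -> measurable A ->
  P ((fun w => X n w 0 k) @^-1` A) = P ((fun w => X 1 w 0 k) @^-1` A).
Proof.
case: X_iid => _ _ idX n0 mA.
apply: (idX n 1 n0 isT ((fun v : borel_rV R d => v 0 k) @^-1` A)).
by rewrite -[X in measurable X]setTI; exact: measurable_coord.
Qed.

Let X_sqr n k c : (0 < n)%N ->
  ('E_P[fun w => ((X n w 0 k - c) ^+ 2)%R] =
   'E_P[fun w => ((X 1 w 0 k - c) ^+ 2)%R])%E.
Proof.
move=> n0.
apply: (identically_distributed_expectation (h := fun x => (x - c) ^+ 2)) => //.
- exact: mX.
- exact: mX.
- by apply: measurable_funX; exact: measurable_funB.
- by move=> A mA; exact: X_dist.
- by left => x; exact: sqr_ge0.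
Qed.

(** Square integrability is assumed for [X 1] and reaches [X n] through the common law, by [X_sqr]
    with shift 0. *)
Let X_Lfun2 n k : (0 < n)%N -> (fun w => X n w 0 k) \in Lfun P 2%:E.
Proof.
move=> n0; apply: Lfun2P; first exact: mX.
have := X_sqr k 0 n0.
under eq_fun do rewrite subr0.
under [in RHS]eq_fun do rewrite subr0.
move=> ->; have /expectation_fin_num := Lfun2_sqr (X1_Lfun2 k).
by rewrite fin_numElt => /andP[].
Qed.

Let X_mean n k : (0 < n)%N -> ('E_P[fun w => (X n w 0 k)%R] = (m 0%R k)%:E)%E.
Proof.
move=> n0; rewrite mxE fineK ?expectation_fin_num ?Lfun2_Lfun1//.
apply: (identically_distributed_expectation (h := id)) => //.
- exact: mX.
- exact: mX.
- by move=> A mA; exact: X_dist.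
- by right; split; apply: Lfun2_Lfun1; exact: X_Lfun2.
Qed.

Let Z n k w := X n w 0 k - m 0 k.

Let Z_Lfun2 n k : (0 < n)%N -> Z n k \in Lfun P 2%:E.
Proof. by move=> n0; apply: Lfun2_subr_cst; exact: X_Lfun2. Qed.

Let Z_mean n k : (0 < n)%N -> ('E_P[Z n k] = 0)%E.
Proof.
move=> n0; have := expectation_centered (Lfun2_Lfun1 (X_Lfun2 k n0)).
by rewrite X_mean.
Qed.

Let Z_uncorrelated k i j : (0 < i)%N -> (0 < j)%N -> i != j ->
  ('E_P[Z i k \* Z j k] = 0)%E.
Proof.
move=> i0 j0 ij.
rewrite expectation_independentM ?Z_mean ?mule0 ?Lfun2_mul_Lfun1 ?Lfun2_Lfun1 ?Z_Lfun2//.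
move=> A B mA mB.
(* Events about [Z i k] are rewritten as preimages under [X i] of Borel sets of R^d, the form in
   which independence is given. *)
pose shift_coord (v : borel_rV R d) := v 0 k - m 0 k.
have mshift : measurable_fun setT shift_coord.
  by apply: measurable_funB => //; exact: measurable_coord.
case: X_iid => _ indX _.
apply: (independent_pair (A := shift_coord @^-1` A) (B := shift_coord @^-1` B)
  indX i0 j0 ij).
- by rewrite -[X in measurable X]setTI; exact: mshift.
- by rewrite -[X in measurable X]setTI; exact: mshift.
Qed.

Variables (a : nat -> R) (xi : 'rV[R]_d) (Theta : nat -> Omega -> 'rV[R]_d).
Hypothesis Theta_0 : forall w, Theta 0 w = xi.
Hypothesis Theta_S : forall n w,
  Theta n.+1 w = Theta n w - a n.+1 *: (Theta n w - X n.+1 w).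

Let T k n w := Theta n w 0 k - m 0 k.

Let T_0 k w : T k 0 w = xi 0 k - m 0 k.
Proof. by rewrite /T Theta_0. Qed.

Let T_S k n w : T k n.+1 w = (1 - a n.+1) * T k n w + a n.+1 * Z n.+1 k w.
Proof. by rewrite /T Theta_S /Z; move: (m 0 k) => mk; rewrite !mxE; ring. Qed.

Let T_Lfun2 k n : T k n \in Lfun P 2%:E.
Proof. exact: averaging_Lfun2 (fun n => @Z_Lfun2 n k) (T_0 k) (T_S k) n. Qed.

Let enorm_ThetaE n :
  (fun w => enorm (Theta n w - m) ^+ 2) = fun w => \sum_(k < d) T k n w ^+ 2.
Proof.
by apply/funext => w; rewrite enorm_sqrB.
Qed.

Lemma sgd_error_Lfun1 n : (fun w => enorm (Theta n w - m) ^+ 2) \in Lfun P 1.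
Proof.
apply: enorm_sqr_Lfun1 => k.
rewrite (_ : (fun _ => _) = T k n); first exact: T_Lfun2.
by apply/funext => w; rewrite subrVE.
Qed.

(** The squared norm splits into coordinates, each obeying the scalar second-moment recursion with
    the same factors, so the recursions add up. *)
Lemma sgd_error_recursion n :
  fine ('E_P[fun w => (enorm (Theta n.+1 w - m) ^+ 2)%R])%E =
  (1 - a n.+1) ^+ 2 * fine ('E_P[fun w => (enorm (Theta n w - m) ^+ 2)%R])%E +
  a n.+1 ^+ 2 * fine ('E_P[fun w => (enorm (X 1 w - m) ^+ 2)%R])%E.
Proof.
have sumT j : fine ('E_P[fun w => (enorm (Theta j w - m) ^+ 2)%R])%E =
    \sum_(k < d) fine ('E_P[fun w => (T k j w ^+ 2)%R])%E.
  rewrite enorm_ThetaE expectation_sum_ord; last by move=> k; exact: Lfun2_sqr.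
  by rewrite -sum_fine// => k _; rewrite expectation_fin_num// Lfun2_sqr.
have Zsqr k j : (0 < j)%N -> ('E_P[fun w => (Z j k w ^+ 2)%R] =
    (fine 'E_P[fun w => (Z 1 k w ^+ 2)%R])%:E)%E.
  move=> j0; rewrite fineK; first exact: X_sqr.
  by rewrite expectation_fin_num// Lfun2_sqr// Z_Lfun2.
rewrite !sumT (expectation_enorm_sqrB _ X1_Lfun2) -sum_fine; last first.
  by move=> k _; rewrite expectation_fin_num// Lfun2_sqr// Z_Lfun2.
rewrite !big_distrr -big_split; apply: eq_bigr => k _ /=.
exact: (averaging_second_moment (fun j => @Z_Lfun2 j k) (fun j => @Z_mean j k)
  (Zsqr k) (@Z_uncorrelated k) (T_0 k) (T_S k)).
Qed.

End stochastic_gradient_descent.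

(** * The quadratic objective and the convergence rates of the descent *)

Theorem theorem4p13 (R : realType) (d : nat) (d_gt0 : (0 < d)%N)
    (alpha gamma nu : R)
    (alpha_gt0 : 0 < alpha) (gamma_gt0 : 0 < gamma) (nu_gt0 : 0 < nu)
    (xi : 'rV[R]_d)
    (disp : measure_display) (Omega : measurableType disp)
    (P : probability Omega R)
    (X : nat -> Omega -> 'rV[R]_d)
    (X_iid : iid P [set n | (0 < n)%N] X)
    (X_square_integrable :
      ('E_P[fun w => (enorm (X 1%N w) ^+ 2)%R] < +oo)%E)
    (X_nondegenerate :
      (P [set w | X 1%N w = mean_vector P (X 1%N)] < 1)%E)
    (F : 'rV[R]_d -> 'rV[R]_d -> R)
    (F_def : forall theta x, F theta x = alpha / 2 * enorm (theta - x) ^+ 2)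
    (f : 'rV[R]_d -> R)
    (f_def : forall theta, (f theta)%:E = ('E_P[fun w => F theta (X 1%N w)])%E)
    (Theta : nat -> Omega -> 'rV[R]_d)
    (Theta_process : forall n, random_vector (Theta n))
    (Theta_init : forall w, Theta 0%N w = xi)
    (Theta_step : forall n, (0 < n)%N -> forall w,
      Theta n w = Theta n.-1 w -
        (gamma / n%:R `^ nu) *:
          gradient (fun theta => F theta (X n w)) (Theta n.-1 w)) :
  let m := mean_vector P (X 1%N) in
  (forall theta, (f theta)%:E =
      ((alpha / 2 * enorm (theta - m) ^+ 2)%:E +
       (alpha / 2)%:E * 'E_P[fun w => (enorm (X 1%N w - m) ^+ 2)%R])%E) /\
  ([set theta | (f theta)%:E = ereal_inf (range (fun w => (f w)%:E))]
     = [set m]) /\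
  (forall theta, differentiable f theta /\
      dotp (theta - m) (gradient f theta) = alpha * enorm (theta - m) ^+ 2) /\
  (forall theta, enorm (gradient f theta) = alpha * enorm (theta - m)) /\
  (forall theta,
      'E_P[fun w => (enorm (gradient (fun t => F t (X 1%N w)) theta
                            - gradient f theta) ^+ 2)%R] =
      (alpha ^+ 2)%:E * 'E_P[fun w => (enorm (X 1%N w - m) ^+ 2)%R])%E /\
  (forall eps : R, 0 < eps -> exists C0 C1 : R, 0 < C0 /\ 0 < C1 /\
      forall n, (0 < n)%N ->
        ((C0 * n%:R `^ (- rate alpha gamma nu eps 0))%:E
           <= 'E_P[fun w => (enorm (Theta n w - m) ^+ 2)%R] `^ (1 / 2))%E /\
        ('E_P[fun w => (enorm (Theta n w - m) ^+ 2)%R] `^ (1 / 2)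
           <= (C1 * n%:R `^ (- rate alpha gamma nu eps 1))%:E)%E) /\
  (forall eps : R, 0 < eps -> exists C0 C1 : R, 0 < C0 /\ 0 < C1 /\
      forall n, (0 < n)%N ->
        ((C0 * n%:R `^ (- (2 * rate alpha gamma nu eps 0)))%:E
           <= 'E_P[fun w => f (Theta n w)] - (f m)%:E)%E /\
        ('E_P[fun w => f (Theta n w)] - (f m)%:E
           <= (C1 * n%:R `^ (- (2 * rate alpha gamma nu eps 1)))%:E)%E).
Proof.
move=> m.
have gradF x theta : gradient (fun t => F t x) theta = alpha *: (theta - x).
  rewrite (_ : (fun _ => _) = fun t => alpha / 2 * enorm (t - x) ^+ 2 + 0).
    exact: gradient_quadratic.
  by apply/funext => t; rewrite F_def addr0.
have rX1 : random_vector (X 1%N) by case: X_iid => rX _ _; exact: rX.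
have X1_Lfun2 k : (fun w => X 1%N w 0 k) \in Lfun P 2%:E.
  exact: random_vector_coord_Lfun2.
have sqr1 theta : (fun w => enorm (X 1%N w - theta) ^+ 2) \in Lfun P 1.
  apply: enorm_sqr_Lfun1 => k.
  rewrite (_ : (fun _ => _) = fun w => X 1%N w 0 k - theta 0 k).
    exact: Lfun2_subr_cst.
  by apply/funext => w; rewrite !mxE.
pose V := fine ('E_P[fun w => (enorm (X 1%N w - m) ^+ 2)%R])%E.
have VE : ('E_P[fun w => (enorm (X 1%N w - m) ^+ 2)%R] = V%:E)%E.
  by rewrite fineK// expectation_fin_num.
have V_gt0 : 0 < V by rewrite -lte_fin -VE; exact: expectation_enorm_sqrB_gt0.
(* This closed form, from the bias-variance decomposition, yields the minimiser, the gradient of f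
   and the excess risk. *)
have fE theta : f theta = alpha / 2 * enorm (theta - m) ^+ 2 + alpha / 2 * V.
  apply: EFin_inj; rewrite f_def.
  rewrite (_ : (fun _ => _) = (alpha / 2) \o* (fun w => enorm (X 1%N w - theta) ^+ 2)).
    rewrite expectationZl// expectation_enorm_sqr_shift// -/m VE.
    by rewrite -EFinD -EFinM mulrDr.
  by apply/funext => w /=; rewrite F_def -(enormN (theta - _)) opprB mulrC.
have fm : f m = alpha / 2 * V.
  by rewrite fE (enorm_sqrB_eq0 m m).2// mulr0 add0r.
have fEf : f = fun theta => alpha / 2 * enorm (theta - m) ^+ 2 + alpha / 2 * V.
  exact/funext.
have gradf theta : gradient f theta = alpha *: (theta - m).
  by rewrite fEf; exact: gradient_quadratic.
have a2 : 0 < alpha / 2 by rewrite divr_gt0.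
have a0 := ltW alpha_gt0.
split; first by move=> theta; rewrite VE fE EFinD !EFinM.
split.
  have f_min theta : f m <= f theta.
    by rewrite fm fE lerDr mulr_ge0 ?sqr_ge0 ?(ltW a2).
  have -> : ereal_inf (range (fun w => (f w)%:E)) = (f m)%:E.
    apply/eqP; rewrite eq_le; apply/andP; split.
      by apply: ereal_inf_lbound; exists m.
    by apply: le_ereal_inf_tmp => _ [t _ <-]; rewrite lee_fin.
  apply/seteqP; split => theta /=; last by move=> ->.
  move=> [] /eqP; rewrite fE fm -subr_eq0 addrK mulf_eq0 gt_eqF//= => /eqP.
  by move/enorm_sqrB_eq0.
split.
  move=> theta; split; first by rewrite fEf; exact: differentiable_quadratic.
  by rewrite gradf dotpZr dotpE.
split; first by move=> theta; rewrite gradf enormZ.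
split.
  move=> theta.
  rewrite (_ : (fun _ => _) = (alpha ^+ 2) \o* (fun w => enorm (X 1%N w - m) ^+ 2)).
    by rewrite expectationZl.
  (* The point theta cancels: the difference of the gradients is alpha (m - X_1). *)
  apply/funext => w /=; rewrite gradF gradf -scalerBr opprB addrC subrKA.
  by rewrite enormZ// -opprB enormN exprMn mulrC.
pose a n : R := gamma * alpha * n%:R `^ (- nu).
have Theta_S n w : Theta n.+1 w = Theta n w - a n.+1 *: (Theta n w - X n.+1 w).
  by rewrite Theta_step//= gradF scalerA /a powRN [gamma * alpha * _]mulrAC.
pose e n := fine ('E_P[fun w => (enorm (Theta n w - m) ^+ 2)%R])%E.
have eL n : (fun w => enorm (Theta n w - m) ^+ 2) \in Lfun P 1.
  exact: (sgd_error_Lfun1 X_iid X_square_integrable Theta_init Theta_S).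
have eE n : ('E_P[fun w => (enorm (Theta n w - m) ^+ 2)%R] = (e n)%:E)%E.
  by rewrite fineK// expectation_fin_num.
have e_ge0 n : 0 <= e n.
  by apply: fine_ge0; apply: expectation_ge0 => w; exact: sqr_ge0.
have eS n := sgd_error_recursion X_iid X_square_integrable Theta_init Theta_S n.
split=> eps eps_gt0.
  have [C0 [C1 [C0_gt0 C1_gt0 HC]]] :=
    recursion_rate alpha_gt0 gamma_gt0 nu_gt0 V_gt0 (e_ge0 0%N) eps_gt0 eS.
  (* The rates are known for the squared error; taking roots takes the root of each constant and
     halves the exponent. *)
  exists (C0 `^ (1 / 2)), (C1 `^ (1 / 2)).
  split; first exact: powR_gt0.
  split; first exact: powR_gt0.
  move=> n n0; rewrite eE poweR_EFin !lee_fin.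
  have sqrt_rate C r : 0 < C ->
      C `^ (1 / 2) * n%:R `^ (- r) = (C * n%:R `^ (- (2 * r))) `^ (1 / 2) :> R.
    move=> C_gt0; rewrite powRM ?powR_ge0 ?ltW// -powRrM.
    by congr (_ * _ `^ _); field.
  have /andP[lo hi] := HC n n0.
  rewrite !sqrt_rate//; split; apply: ge0_ler_powR; rewrite ?nnegrE//.
  - by rewrite mulr_ge0 ?powR_ge0 ?(ltW C0_gt0).
  - by rewrite mulr_ge0 ?powR_ge0 ?(ltW C1_gt0).
have [C0 [C1 [C0_gt0 C1_gt0 HC]]] :=
  recursion_rate alpha_gt0 gamma_gt0 nu_gt0 V_gt0 (e_ge0 0%N) eps_gt0 eS.
exists (alpha / 2 * C0), (alpha / 2 * C1).
split; first exact: mulr_gt0.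
split; first exact: mulr_gt0.
move=> n n0.
(* The excess risk is exactly alpha/2 times the squared error, so the same rates hold with rescaled
   constants. *)
have -> : ('E_P[fun w => f (Theta n w)] - (f m)%:E = (alpha / 2 * e n)%:E)%E.
  rewrite (_ : (fun _ => _) = fun w => alpha / 2 * enorm (Theta n w - m) ^+ 2 +
    f m * cst 1 w).
    rewrite expectation_lincomb ?Lfun_cst// expectation_cst mule1 eE.
    by rewrite -EFinM -EFinD addrK.
  by apply/funext => w; rewrite fE fm mulr1.
have /andP[lo hi] := HC n n0.
by rewrite !lee_fin -!mulrA !ler_pM2l.
Qed.
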